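(* Let $H$ be a complex Hilbert space, let $K \in \mathcal{L}(H)$ be a positive compact operator and let $R \in \mathcal{L}(H)$ be an operator of finite rank. Then $K+I+R$ satisfies property $\mathcal{AN}$, where $I$ is the identity operator on $H$.
   Context: $\mathcal{L}(H)$ denotes the bounded linear operators on $H$. ''Subspace'' always means closed subspace. $P\in\mathcal{L}(H)$ is positive if $\langle Px,x\rangle\ge 0$ for all $x\in H$. An operator $T\in\mathcal{L}(H,J)$ between complex Hilbert spaces satisfies property $\mathcal{N}$ if there is $x\in H$ with $\|x\|=1$ and $\|Tx\|=\|T\|$. $T$ satisfies property $\mathcal{AN}$ (is an $\mathcal{AN}$ operator) if for every closed subspace $M\subset H$, $M\ne\{0\}$, the restriction $T|_M\in\mathcal{L}(M,J)$ satisfies property $\mathcal{N}$, i.e. there is $x\in M$ with $\|x\|=1$ and $\|Tx\|=\|T|_M\|$. *)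

(* Defs.v *)
From HB Require Import structures.
From mathcomp Require Import all_boot all_order all_algebra complex.
From mathcomp Require Import all_classical all_reals all_analysis.

Set Implicit Arguments.
Unset Strict Implicit.
Unset Printing Implicit Defensive.
Import Order.TTheory GRing.Theory Num.Theory.
Import numFieldNormedType.Exports.

Local Open Scope classical_set_scope.
Local Open Scope complex_scope.
Local Open Scope ring_scope.

(* The inner product is linear in its first argument and conjugate-linear in
   the second. *)
HB.mixin Record CompleteNormedModule_isHilbert (R : realType) (H : Type)
    of CompleteNormedModule R[i] H := {
  inner : {dot H for (@Num.conj R[i])} ;
  inner_normE : forall x : H, inner x x = `|x| ^+ 2
}.

#[short(type="hilbertType")]
HB.structure Definition Hilbert (R : realType) :=
  {H of CompleteNormedModule R[i] H & CompleteNormedModule_isHilbert R H}.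

(* Over R[i] the bound M is not required to be real, but for x != 0 the
   inequality forces it to be real and nonnegative. *)
HB.mixin Record isBoundedOperator (K : numFieldType) (V W : normedModType K)
    (T : V -> W) := {
  bounded_operatorP : exists M : K, forall x : V, `|T x| <= M * `|x|
}.

#[short(type="boundedOperator")]
HB.structure Definition BoundedOperator (K : numFieldType)
    (V W : normedModType K) :=
  {T of @GRing.Linear K V W *:%R T & isBoundedOperator K V W T}.

Notation "{ 'bounded' V -> W }" := (boundedOperator V%type W%type)
  (at level 0, V at level 98, W at level 99,
   format "{ 'bounded'  V  ->  W }") : type_scope.

Section BoundedOperatorInstances.
Variables (K : numFieldType) (V W : normedModType K).

Lemma bounded_idfun : exists M : K, forall x : V, `|idfun x| <= M * `|x|.
Proof. by exists 1 => x; rewrite mul1r. Qed.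

HB.instance Definition _ :=
  isBoundedOperator.Build K V V idfun bounded_idfun.

Lemma bounded_add_fun (S T : {bounded V -> W}) :
  exists M : K, forall x : V, `|(S \+ T) x| <= M * `|x|.
Proof.
have [[M SM] [N TN]] := (@bounded_operatorP _ _ _ S, @bounded_operatorP _ _ _ T).
exists (M + N) => x; rewrite mulrDl.
by rewrite (le_trans (ler_normD _ _))// lerD.
Qed.

HB.instance Definition _ (S T : {bounded V -> W}) :=
  isBoundedOperator.Build K V W (S \+ T) (bounded_add_fun S T).

End BoundedOperatorInstances.

Section Operators.
Variables (R : realType) (H J : hilbertType R).
Implicit Types (M : set H) (T : {bounded H -> J}).

Definition closed_subspace M := submod_closed [in M] /\ closed M.

(* The norm of the restriction of T to M.  The library norm takes values in
   R[i]; its real part carries it to R, where suprema are available. *)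
Definition restr_opnorm T M : R :=
  sup [set complex.Re `|T x| | x in M `&` [set x | `|x| <= 1]].

Definition restr_property_N T M :=
  exists x : H, [/\ M x, `|x| = 1 & `|T x| = (restr_opnorm T M)%:C].

Definition property_AN T :=
  forall M, closed_subspace M -> M <> [set 0] -> restr_property_N T M.

Definition compact_operator T := precompact (T @` [set x | `|x| <= 1]).

Definition finite_rank T :=
  exists n (v : 'I_n -> J),
    range T = [set \sum_(i < n) c i *: v i | c in [set: 'I_n -> R[i]]].

End Operators.

(* On R[i], 0 <= z asserts that z is real and nonnegative. *)
Definition positive_operator (R : realType) (H : hilbertType R)
  (P : {bounded H -> H}) := forall x : H, 0 <= inner (P x) x.

(* Main.v *)
(* Let T = I + K + F, let s be the norm of T on M, and take an ultrafilter U of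
   unit vectors of M along which |T x| tends to s.  The images of U under K and
   F converge, so it suffices that U itself converges: its limit attains s.
   - If F kills a unit vector x of M, then s >= |T x| = |x + K x| >= 1.  When
     s = 1, x attains the norm.  When s > 1, the parallelogram law gives
     (s ^ 2 - 1) |x - y| ^ 2 -> 0 for x, y along U, so U is Cauchy.
   - Otherwise F is injective on M, so M is finite-dimensional and U converges
     by compactness. *)
Require Import Defs.
From HB Require Import structures.
From mathcomp Require Import all_boot all_order all_algebra complex.
From mathcomp Require Import all_classical all_reals all_analysis.
From mathcomp Require Import ring lra.

Set Implicit Arguments.
Unset Strict Implicit.
Unset Printing Implicit Defensive.
Import Order.TTheory GRing.Theory Num.Theory.
Import numFieldNormedType.Exports.
Local Open Scope classical_set_scope.
Local Open Scope complex_scope.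
Local Open Scope ring_scope.

(** Compactness gives the image filter a cluster point [p]. An ultrafilter contains the preimage of
    each neighbourhood of [p] or the complement of that preimage, and the complement would keep the
    image away from [p]. *)
Lemma compact_ultra_cvg (T : Type) (X : topologicalType) (U : set_system T)
    (f : T -> X) (A : set X) :
  UltraFilter U -> compact A -> U (f @^-1` A) -> exists p : X, f @ U --> p.
Proof.
move=> UU cA UA; have [p [Ap clp]] := cA (f @ U) _ UA.
exists p => V Vp.
have [//|UV] := in_ultra_setVsetC (f @^-1` V) UU.
by have [y [/= nVy Vy]] := clp (~` V) V UV Vp.
Qed.

(** * Real-valued norms and bounded operators *)

Section RealNorm.
Context {R : realType} {V : normedModType R[i]}.
Implicit Types x y : V.

Definition rnorm x : R := complex.Re `|x|.

Lemma rnormE x : `|x| = (rnorm x)%:C.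
Proof. by rewrite RRe_real// normr_real. Qed.

Lemma rnorm_ge0 x : 0 <= rnorm x.
Proof. by rewrite -lecR -rnormE normr_ge0. Qed.

Lemma ler_rnormD x y : rnorm (x + y) <= rnorm x + rnorm y.
Proof. by rewrite -lecR rmorphD/= -!rnormE ler_normD. Qed.

Lemma rnormN x : rnorm (- x) = rnorm x.
Proof. by rewrite /rnorm normrN. Qed.

Lemma ler_rnormB x y : rnorm (x - y) <= rnorm x + rnorm y.
Proof. by rewrite -(rnormN y) ler_rnormD. Qed.

Lemma rnormZ (a : R) x : 0 <= a -> rnorm (a%:C *: x) = a * rnorm x.
Proof.
move=> a0; apply: complexI; rewrite rmorphM/= -!rnormE normrZ.
by rewrite ger0_norm// ler0c.
Qed.

Lemma rnorm_eq0 x : (rnorm x == 0) = (x == 0).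
Proof. by rewrite -(normr_eq0 x) rnormE fmorph_eq0. Qed.

Lemma rnorm0 : rnorm 0 = 0.
Proof. by apply/eqP; rewrite rnorm_eq0. Qed.

Lemma rnorm1E x : `|x| = 1 <-> rnorm x = 1.
Proof.
by rewrite rnormE; split => [h|->]//; apply: complexI.
Qed.

Lemma rnorm_cvg (T : Type) (U : set_system T) {PU : ProperFilter U}
    (f : T -> V) (l : V) :
  (f @ U --> l) <-> (forall e : R, 0 < e -> \near U, rnorm (l - f U) < e).
Proof.
split=> [/cvgrPdist_lt fl e e0|fl].
  have := fl e%:C; rewrite ltcR => /(_ e0); apply: filterS => t.
  by rewrite rnormE ltcR.
apply/cvgrPdist_lt => e e0.
have eE : e = (complex.Re e)%:C by rewrite RRe_real// gtr0_real.
move: e0; rewrite eE ltcR => /fl; apply: filterS => t.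
by rewrite rnormE ltcR.
Qed.

Lemma rnorm_cauchy (U : set_system V) {PU : ProperFilter U} :
  (forall e : R, 0 < e -> exists x, U [set y | rnorm (x - y) < e]) ->
  cauchy U.
Proof.
move=> h; apply: cauchy_exP => e e0.
have eE : e = (complex.Re e)%:C by rewrite RRe_real// gtr0_real.
move: e0; rewrite eE ltcR => /h[x Ux]; exists x; apply: filterS Ux => y /=.
by rewrite -ball_normE/= rnormE ltcR.
Qed.

End RealNorm.

(** A nonzero vector forces the given bound [M] to be nonnegative, but on the zero space [M] is
    arbitrary, so it is replaced by its modulus. Adding 1 makes the bound positive, so that one can
    divide by it. *)
Lemma bounded_rnorm (R : realType) (V W : normedModType R[i])
  (T : {bounded V -> W}) :
  exists2 B : R, 0 < B & forall x : V, rnorm (T x) <= B * rnorm x.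
Proof.
have [M TM] := @bounded_operatorP _ _ _ T.
have ME := rnormE M; have := rnorm_ge0 M; move: (rnorm M) ME => m ME m0.
exists (1 + m) => [|x]; first by rewrite ltr_pwDl.
rewrite -lecR rmorphM/= rmorphD/= -!rnormE -ME.
have [->|x0] := eqVneq x 0; first by rewrite linear0 !normr0 mulr0.
apply: (le_trans (TM x)); rewrite ler_pM2r ?normr_gt0//.
rewrite ger0_norm ?lerDr ?ler01//.
by rewrite -(@pmulr_lge0 _ `|x|) ?normr_gt0// (le_trans _ (TM x)).
Qed.

Lemma bounded_operator_continuous (R : realType) (V W : normedModType R[i])
    (T : {bounded V -> W}) : continuous T.
Proof.
move=> x; apply/rnorm_cvg.
have [B B0 TB] := bounded_rnorm T => e e0.
have /(_ _ (e / B)) := (@rnorm_cvg _ _ _ (nbhs x) _ id x).1 (@cvg_id _ _).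
rewrite divr_gt0// => /(_ isT); apply: filterS => t.
rewrite ltr_pdivlMr// mulrC -linearB; apply: le_lt_trans; exact: TB.
Qed.

(** The real and imaginary parts eventually lie in the compact segment from [- B] to [B], so both
    converge along [U]. *)
Lemma complex_ultra_cvg (R : realType) (T : Type) (U : set_system T)
    (f : T -> (R[i] : numFieldType)) (B : R) :
  UltraFilter U -> (\forall t \near U, `|f t| <= B%:C) -> exists l : (R[i] : numFieldType), f @ U --> l.
Proof.
move=> UU fB.
have part (g : R[i] -> R) : (forall z, `|g z|%:C <= `|z|) ->
    exists a : R, g \o f @ U --> a.
  move=> gz; apply: (@compact_ultra_cvg _ _ _ _ `[- B, B]%classic UU).
    exact: segment_compact.
  apply: filterS fB => t ft /=; rewrite in_itv/= -ler_norml -lecR.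
  exact: le_trans (gz _) ft.
have /part[a fa] : forall z : R[i], `|complex.Re z|%:C <= `|z|.
  by move=> z; rewrite normc_def lecR -sqrtr_sqr ler_wsqrtr// lerDl sqr_ge0.
have /part[b fb] : forall z : R[i], `|complex.Im z|%:C <= `|z|.
  by move=> z; rewrite normc_def lecR -sqrtr_sqr ler_wsqrtr// lerDr sqr_ge0.
exists (a +i* b); apply/cvgrPdist_lt => e e0.
have eE : e = (complex.Re e)%:C by rewrite RRe_real// gtr0_real.
move: e0; rewrite eE ltcR => e0.
have e2 : 0 < complex.Re e / 2 by rewrite divr_gt0.
move/cvgrPdist_lt/(_ _ e2) : fa => fa; move/cvgrPdist_lt/(_ _ e2) : fb => fb.
near=> t.
have -> : a +i* b - f t =
    (a - complex.Re (f t))%:C + 'i%C * (b - complex.Im (f t))%:C.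
  by rewrite [LHS]complexE; case: (f t).
rewrite (le_lt_trans (ler_normD _ _))// normrM.
have -> : `|'i%C| = 1 :> R[i].
  by rewrite normc_def/= expr0n/= add0r expr1n sqrtr1.
rewrite mul1r.
have nr (r : R) : `|r%:C| = `|r|%:C.
  by rewrite normc_def/= expr0n/= addr0 sqrtr_sqr.
rewrite !nr -rmorphD/= ltcR [ltRHS]splitr; apply: ltrD; near: t.
  exact: fa.
exact: fb.
Unshelve. all: by end_near. Qed.

(** * Inner product inequalities *)

Section Hilbert.
Context {R : realType} {H : hilbertType R}.
Implicit Types (x y : H) (M P : set H) (s e : seq H).

Lemma inner_conj x y : inner x y = (inner y x)^*.
Proof. by rewrite hermC/= mul1r. Qed.

Lemma normrD_inner x y :
  `|x + y| ^+ 2 = `|x| ^+ 2 + `|y| ^+ 2 + (inner x y + (inner x y)^*).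
Proof. by rewrite -!inner_normE dnormD. Qed.

(** Pythagoras for [x = z + a *: y], where [a *: y] is the projection of [x] onto the line of [y];
    the inequality follows by dropping the contribution of [z]. *)
Lemma cauchy_schwarz x y : `|inner x y| <= `|x| * `|y|.
Proof.
have [->|y0] := eqVneq y 0; first by rewrite linear0r !normr0 mulr0.
have y2 : `|y| ^+ 2 != 0 by rewrite expf_neq0// normr_eq0.
pose a := inner x y / `|y| ^+ 2; pose z := x - a *: y.
have zy : inner z y = 0.
  by rewrite linearBl linearZl_LR/= inner_normE /a divfK// subrr.
have xE : x = z + a *: y by rewrite subrK.
have : `|x| ^+ 2 = `|z| ^+ 2 + `|a| ^+ 2 * `|y| ^+ 2.
  rewrite {1}xE normrD_inner linearZr_LR/= zy mulr0 rmorph0 !addr0.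
  by rewrite normrZ exprMn.
rewrite /a normrM normfV normrX normr_id => xz.
rewrite -(@ler_pXn2r _ 2)// ?nnegrE ?mulr_ge0//.
rewrite exprMn xz mulrDl -[leLHS]add0r lerD ?mulr_ge0 ?exprn_ge0//.
by rewrite exprMn exprVn -mulrA -expr2 divfK// expf_neq0.
Qed.

Lemma rnorm_parallelogram x y :
  rnorm (x + y) ^+ 2 + rnorm (x - y) ^+ 2
    = 2 * rnorm x ^+ 2 + 2 * rnorm y ^+ 2.
Proof.
apply: complexI; rewrite !(rmorphD, rmorphM, rmorphXn)/= -!rnormE.
rewrite -!expr2 !normrD_inner normrN linearNr rmorphN/= rmorph1.
by ring.
Qed.

(** In the expansion of the squared norm of [K x + x], the cross terms are nonnegative because [K]
    is positive. *)
Lemma ler_rnorm_addP (K : {bounded H -> H}) x :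
  positive_operator K -> rnorm x <= rnorm (K x + x).
Proof.
move=> Kpos; rewrite -(@ler_pXn2r _ 2)// ?nnegrE ?rnorm_ge0//.
rewrite -lecR !rmorphXn/= -!rnormE normrD_inner addrAC -[leLHS]add0r lerD//.
by rewrite !addr_ge0 ?exprn_ge0// conjC_ge0.
Qed.

(** * Subspaces, finite spans and orthonormalization *)

Definition is_subspace M :=
  M 0 /\ forall (a : R[i]) x y, M x -> M y -> M (a *: x + y).

Lemma submod_closed_subspace M : submod_closed [in M] -> is_subspace M.
Proof.
move=> [M0 Ml]; split=> [|a x y Mx My]; first by rewrite !inE in M0.
by apply: set_mem; apply: (Ml a x y); exact: mem_set.
Qed.

Lemma subspaceB M x y : is_subspace M -> M x -> M y -> M (x - y).
Proof.
by move=> [_ Ml] Mx My; rewrite addrC -scaleN1r; apply: Ml.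
Qed.

Lemma subspaceD M x y : is_subspace M -> M x -> M y -> M (x + y).
Proof. by move=> [_ Ml] Mx My; rewrite -[x]scale1r; apply: Ml. Qed.

Lemma subspaceZ M (a : R[i]) x : is_subspace M -> M x -> M (a *: x).
Proof. by move=> [M0 Ml] Mx; rewrite -[_ *: _]addr0; apply: Ml. Qed.

(* M lies in the linear span of s, expressed without linear combinations. *)
Definition spanned_by s M :=
  forall P, is_subspace P -> (forall x, x \in s -> P x) -> M `<=` P.

(** The functionals [inner (T x) y], for [y] in [e], separate the points of [M] from 0. The kernel
    of each has codimension at most one, so every induction step adds at most one spanning
    vector. *)
Lemma spanned_by_separating (T : {bounded H -> H}) e M : is_subspace M ->
  (forall x, M x -> (forall y, y \in e -> inner (T x) y = 0) -> x = 0) ->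
  exists s, spanned_by s M.
Proof.
elim: e M => [|y e IH] M Msub sep.
  by exists [::] => P [P0 _] _ x Mx; rewrite (sep x Mx).
pose N := M `&` [set x | inner (T x) y = 0].
have Nsub : is_subspace N.
  split=> [|a x z [Mx /= Tx] [Mz /= Tz]].
    by split; [exact: Msub.1|rewrite /= linear0 linear0l].
  split; first exact: Msub.2.
  by rewrite /= linearP linearDl linearZl_LR/= Tx Tz mulr0 addr0.
have [x [Mx Tx] xe|s sN] := IH N Nsub.
  by apply: sep => // z; rewrite inE => /predU1P[->//|]; exact: xe.
have [[m [Mm Tm]]|noM] := pselect (exists m, M m /\ inner (T m) y <> 0).
  exists (m :: s) => P Psub Ps x Mx.
  (* This coefficient puts [x - a *: m] in the kernel [N]. *)
  pose a := inner (T x) y / inner (T m) y.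
  rewrite -(subrK (a *: m) x); apply: subspaceD => //; last first.
    by apply: subspaceZ => //; apply: Ps; rewrite mem_head.
  apply: (sN P Psub) => [z zs|]; first by apply: Ps; rewrite inE zs orbT.
  split; first by apply: subspaceB => //; exact: subspaceZ.
  rewrite /= linearB/= linearZ/= linearBl linearZl_LR/= divfK ?subrr//.
  exact/eqP.
exists s => P Psub Ps x Mx; apply: (sN P Psub Ps); split => //=.
by apply: contrapT => Tx; apply: noM; exists x.
Qed.

(* For an orthonormal family e this is the orthogonal projection onto its span;
   orthonormality is never needed beyond frame_sum e fixing e pointwise. *)
Definition frame_sum e x : H := \sum_(u <- e) inner x u *: u.

Lemma frame_sumP e a x y :
  frame_sum e (a *: x + y) = a *: frame_sum e x + frame_sum e y.
Proof.
rewrite /frame_sum scaler_sumr -big_split/=; apply: eq_bigr => u _.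
by rewrite linearPl scalerDl scalerA.
Qed.

Lemma frame_sum_subspace e : is_subspace [set x | frame_sum e x = x].
Proof.
split => [|a x y /= ex ey]; last by rewrite /= frame_sumP ex ey.
by rewrite /= /frame_sum big1// => u _; rewrite linear0l scale0r.
Qed.

Lemma frame_sumC e x y : inner (frame_sum e x) y = inner x (frame_sum e y).
Proof.
rewrite /frame_sum linear_sumlz linear_sumr; apply: eq_bigr => u _ /=.
by rewrite linearZl_LR linearZr_LR/= -(inner_conj u y) mulrC.
Qed.

(** Asking that the members of [e] be fixed too makes [frame_sum e] idempotent, so it kills the
    residual [w] of a new vector [v]. If [w] is nonzero, its normalization [u] extends [e]. *)
Lemma gram_schmidt s :
  exists e, forall x, x \in e ++ s -> frame_sum e x = x.
Proof.
elim: s => [|v s [e es]]; first by exists [::].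
have esub := frame_sum_subspace e.
pose w := v - frame_sum e v.
have eidem x : frame_sum e (frame_sum e x) = frame_sum e x.
  rewrite -/([set x | frame_sum e x = x] (frame_sum e x)) {2}/frame_sum big_seq.
  apply: big_ind.
  - exact: esub.1.
  - by move=> x1 x2; exact: subspaceD.
  - by move=> u ue; apply: subspaceZ => //=; apply: es; rewrite mem_cat ue.
have ew : frame_sum e w = 0.
  by rewrite /w -scaleN1r addrC frame_sumP eidem scaleN1r addNr.
have [w0|w0] := eqVneq w 0.
  exists e => x; rewrite mem_cat inE orbCA -mem_cat => /predU1P[->|/es//].
  by apply/esym/subr0_eq.
pose u := `|w|^-1 *: w.
have uu : inner u u = 1.
  by rewrite inner_normE normrZ normfV normr_id mulVf ?expr1n// normr_eq0.
have eu : frame_sum e u = 0.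
  rewrite -[u]addr0 frame_sumP ew scaler0 add0r.
  exact: (frame_sum_subspace e).1.
(* Self-adjointness moves the projection from [x] to [u], which it kills. *)
have uperp x : frame_sum e x = x -> inner x u = 0.
  by move=> <-; rewrite frame_sumC eu linear0r.
exists (u :: e) => x.
rewrite /frame_sum big_cons -/(frame_sum e x) mem_cat !inE.
have old y : frame_sum e y = y -> inner y u *: u + frame_sum e y = y.
  by move=> ey; rewrite (uperp y ey) scale0r add0r.
case/orP => [/predU1P[->|xe]|/predU1P[->|xs]].
- by rewrite uu eu scale1r addr0.
- by apply: old; apply: es; rewrite mem_cat xe.
- have vE : v = w + frame_sum e v by rewrite subrK.
  rewrite {1}vE linearDl/= (uperp _ (eidem v)) addr0.
  have wE : w = `|w| *: u by rewrite scalerA divff ?scale1r// normr_eq0.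
  by rewrite {1}wE linearZl_LR/= uu mulr1 -wE -vE.
- by apply: old; apply: es; rewrite mem_cat xs orbT.
Qed.

(** Bolzano-Weierstrass in finite dimension: a vector of [M] is the sum of its components along [e],
    whose coefficients are bounded by Cauchy-Schwarz and hence converge along [U]. *)
Lemma spanned_ultra_cvg (T : Type) (U : set_system T) (f : T -> H) s M (B : R) :
  UltraFilter U -> spanned_by s M -> (\forall t \near U, M (f t)) ->
  (\forall t \near U, rnorm (f t) <= B) -> exists l : H, f @ U --> l.
Proof.
move=> UU sM UM fB; have [e es] := gram_schmidt s.
have Me x : M x -> frame_sum e x = x.
  move: x; apply: (sM [set x | frame_sum e x = x]).
    exact: frame_sum_subspace.
  by move=> z zs; apply: es; rewrite mem_cat zs orbT.
suff [l fl] : exists l : H, frame_sum e \o f @ U --> l.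
  exists l; apply: cvg_trans fl; apply: near_eq_cvg.
  by apply: filterS UM => t /Me.
rewrite /frame_sum; elim: (e) => [|u r [l rl]].
  exists 0; under eq_fun do rewrite /= big_nil; exact: cvg_cst.
have [|a ua] := @complex_ultra_cvg R T U (fun t => inner (f t) u) (B * rnorm u).
  apply: filterS fB => t ft; apply: (le_trans (cauchy_schwarz _ _)).
  by rewrite !rnormE -rmorphM lecR ler_wpM2r ?rnorm_ge0.
exists (a *: u + l); under eq_fun do rewrite /= big_cons.
by apply: cvgD => //; apply: cvgZr_tmp.
Qed.

End Hilbert.

(** * The norm of the restriction and its maximizing ultrafilters *)

Section RestrictedNorm.
Context {R : realType} {H : hilbertType R}.
Variables (T : {bounded H -> H}) (M : set H).
Hypothesis Msub : is_subspace M.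
Implicit Types x y : H.

Let norms := [set complex.Re `|T x| | x in M `&` [set x | `|x| <= 1]].

Let norms_has_sup : has_sup norms.
Proof.
split.
  exists (rnorm (T 0)), 0 => //.
  by split; [exact: Msub.1|rewrite /= normr0].
have [B B0 TB] := bounded_rnorm T; exists B => _ [x [_ /= x1] <-].
apply: le_trans (TB x) _; rewrite ler_piMr ?(ltW B0)//.
by rewrite -lecR -rnormE.
Qed.

Lemma restr_opnorm_ub x : M x -> rnorm (T x) <= restr_opnorm T M * rnorm x.
Proof.
move=> Mx; have [->|x0] := eqVneq x 0; first by rewrite linear0 !rnorm0 mulr0.
have rx0 : 0 < rnorm x by rewrite lt0r rnorm_eq0 x0 rnorm_ge0.
have ri0 : 0 <= (rnorm x)^-1 by rewrite invr_ge0 ltW.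
rewrite -ler_pdivrMr// mulrC -rnormZ// -linearZ/=.
apply: (sup_upper_bound norms_has_sup); exists ((rnorm x)^-1%:C *: x) => //.
split; first exact: subspaceZ.
by rewrite /= rnormE rnormZ// mulVf ?gt_eqF.
Qed.

Lemma restr_opnorm_adherent (e : R) : M <> [set 0] -> 0 < e ->
  exists x, [/\ M x, rnorm x = 1 & restr_opnorm T M - e < rnorm (T x)].
Proof.
move=> Mn0 e0.
have unit x : M x -> x != 0 ->
    let y := (rnorm x)^-1%:C *: x in M y /\ rnorm y = 1.
  move=> Mx x0; split; first exact: subspaceZ.
  by rewrite rnormZ ?invr_ge0 ?rnorm_ge0// mulVf ?rnorm_eq0.
have [_ [z [Mz z1] <-]] := sup_adherent e0 norms_has_sup.
rewrite -/(restr_opnorm T M) -/(rnorm (T z)) => sz.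
have [z0|z0] := eqVneq z 0.
  (* For [z = 0] the bound [restr_opnorm T M - e] is negative, so any unit vector of [M] serves. *)
  have [x [Mx x0]] : exists x, M x /\ x != 0.
    apply: contrapT => noM; apply: Mn0; apply/seteqP; split=> x /=.
      by move=> Mx; apply/eqP; apply: contrapT => /negP x0; apply: noM; exists x.
    by move=> ->; exact: Msub.1.
  have [Mu u1] := unit x Mx x0; eexists; split; [exact: Mu|exact: u1|].
  by rewrite (lt_le_trans sz)// z0 linear0 rnorm0 rnorm_ge0.
(* Since [z] has norm at most 1, normalizing it can only enlarge the norm of its image. *)
have [Mu u1] := unit z Mz z0; eexists; split; [exact: Mu|exact: u1|].
rewrite linearZ/= rnormZ ?invr_ge0 ?rnorm_ge0// (lt_le_trans sz)//.
rewrite ler_peMl ?rnorm_ge0// invf_ge1 ?lt0r ?rnorm_eq0 ?z0 ?rnorm_ge0//.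
by rewrite -lecR -rnormE.
Qed.

(** The filter form of a maximizing sequence of unit vectors. Only the lower estimate is recorded,
    the upper one being [restr_opnorm_ub]. *)
Definition maximizing (U : set_system H) :=
  [/\ U M, U [set x | rnorm x = 1] &
    forall e : R, 0 < e -> U [set x | restr_opnorm T M - e < rnorm (T x)]].

Lemma maximizing_ultrafilter :
  M <> [set 0] -> exists2 U, UltraFilter U & maximizing U.
Proof.
move=> Mn0.
pose D (e : R) := [set x | [/\ M x, rnorm x = 1 &
  restr_opnorm T M - e < rnorm (T x)]].
pose G := filter_from [set e : R | 0 < e] D.
have GF : ProperFilter G.
  apply: filter_from_proper; last first.
    by move=> e /= e0; have [x Dx] := restr_opnorm_adherent Mn0 e0; exists x.
  apply: filter_from_filter; first by exists 1 => /=.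
  move=> a b /= a0 b0; exists (Num.min a b) => /=; first by rewrite lt_min a0.
  move=> x [Mx x1 sx]; split; split => //; apply: le_lt_trans sx.
    by rewrite lerD2l lerN2 ge_min lexx.
  by rewrite lerD2l lerN2 ge_min lexx orbT.
have [U [UU GU]] := ultraFilterLemma GF.
exists U => //; split=> [||e e0]; apply: GU.
- by exists 1 => //= x [].
- by exists 1 => //= x [].
- by exists e => //= x [].
Qed.

Lemma rnorm_comp_cvg (A : Type) (U : set_system A) {PU : ProperFilter U}
    (f : A -> H) (l : H) :
  f @ U --> l -> rnorm \o f @ U --> rnorm l.
Proof.
move=> /rnorm_cvg fl; apply/cvgrPdist_lt => e e0.
apply: filterS (fl e e0) => t; apply: le_lt_trans => /=.
have h1 := ler_rnormD (f t - l) l; have h2 := ler_rnormD (l - f t) (f t).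
rewrite subrK -(rnormN (f t - l)) opprB in h1; rewrite subrK in h2.
by rewrite ler_norml; apply/andP; split; lra.
Qed.

(** The limit lies in [M] by closedness; its norm and that of its image are found by continuity and
    uniqueness of limits in [R]. *)
Lemma maximizing_cvg (U : set_system H) (l : H) : ProperFilter U ->
  closed M -> maximizing U -> U --> l -> restr_property_N T M.
Proof.
move=> PU Mcl [UM U1 Us] Ul; exists l; split.
- exact: (closed_cvg M Mcl UM).
- apply/rnorm1E; apply: (@cvg_unique _ (@Rhausdorff R) (rnorm \o id @ U)).
    exact: rnorm_comp_cvg.
  apply: cvg_near_cst; exact: U1.
- rewrite rnormE; congr (_%:C).
  apply: (@cvg_unique _ (@Rhausdorff R) (rnorm \o T @ U)).
    apply: rnorm_comp_cvg; apply: cvg_comp Ul _.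
    exact: bounded_operator_continuous.
  apply/cvgrPdist_lt => e e0; near=> x.
  have x1 : rnorm x = 1 by near: x.
  have Mx : M x by near: x.
  have := restr_opnorm_ub Mx; rewrite x1 mulr1 /= => Tx.
  rewrite ger0_norm ?subr_ge0// ltrBlDr addrC -ltrBlDr.
  by near: x; exact: Us.
Unshelve. all: by end_near. Qed.

(** As [S] is nearly constant along [U], [T] nearly preserves the distance of [x] and [y], while it
    stretches [x + y] by at most [s]. Comparing the parallelogram laws for [x, y] and [T x, T y]
    bounds [s ^+ 2 - 1] times the squared distance. *)
Lemma maximizing_cauchy (S : {bounded H -> H}) (U : set_system H) (l : H) :
  ProperFilter U -> (forall x, T x = x + S x) -> 1 < restr_opnorm T M ->
  maximizing U -> S @ U --> l -> cauchy U.
Proof.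
move=> PU TE; set s := restr_opnorm T M => s1 [UM U1 Us] /rnorm_cvg Sl.
apply: rnorm_cauchy => e e0.
have s21 : 0 < s ^+ 2 - 1 by rewrite subr_gt0 expr_gt1// ltW// (lt_trans ltr01).
(* The bound 1 keeps [s - d] positive, so that inequalities can be squared; 32 is twice the constant
   16 obtained in [qs], which makes the final inequality strict. *)
pose d := Num.min 1 ((s ^+ 2 - 1) * e ^+ 2 / (32 * s)).
have s0 : 0 < s := lt_trans ltr01 s1.
have d0 : 0 < d.
  by rewrite lt_min ltr01/= divr_gt0 ?mulr_gt0 ?exprn_gt0.
have d1 : d <= 1 by rewrite ge_min lexx.
have de : 32 * s * d <= (s ^+ 2 - 1) * e ^+ 2.
  by rewrite mulrC -ler_pdivlMr ?mulr_gt0// ge_min lexx orbT.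
have UA : U [set x | [/\ M x, rnorm x = 1, s - d < rnorm (T x)
                      & rnorm (l - S x) < d]].
  near=> x; split; near: x => //; [exact: Us|exact: Sl].
have [x [Mx x1 Tx Sx]] := filter_ex UA; exists x.
apply: filterS UA => y [My y1 Ty Sy] /=.
have pxy := rnorm_parallelogram x y.
have pTxy := rnorm_parallelogram (T x) (T y).
have Tsum : rnorm (T x + T y) <= s * rnorm (x + y).
  by rewrite -linearD; apply: restr_opnorm_ub; exact: subspaceD.
have Tdiff : rnorm (T x - T y) <= rnorm (x - y) + 2 * d.
  have -> : T x - T y = (x - y) + ((l - S y) - (l - S x)).
    rewrite !TE opprD addrACA; congr (_ + _).
    by rewrite opprB [RHS]addrC addrA subrK.
  rewrite (le_trans (ler_rnormD _ _))// lerD2l.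
  by rewrite (le_trans (ler_rnormB _ _))// mulr_natl mulr2n lerD ?ltW.
have xy2 : rnorm (x - y) <= 2.
  by rewrite (le_trans (ler_rnormB _ _))// x1 y1.
have := rnorm_ge0 (x - y); have := rnorm_ge0 (x + y).
have := rnorm_ge0 (T x - T y); have := rnorm_ge0 (T x + T y).
move: Tx Ty Tsum Tdiff xy2 pxy pTxy; rewrite x1 y1.
move: (rnorm (T x)) (rnorm (T y)) (rnorm (T x + T y)) (rnorm (T x - T y)).
move: (rnorm (x + y)) (rnorm (x - y)) => p q a b c r.
move=> sa sb cp rq q2 pxy pab c0 r0 p0 q0.
have a2 : (s - d) ^+ 2 <= a ^+ 2 by rewrite ler_pXn2r ?nnegrE//; lra.
have b2 : (s - d) ^+ 2 <= b ^+ 2 by rewrite ler_pXn2r ?nnegrE//; lra.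
have c2 : c ^+ 2 <= s ^+ 2 * p ^+ 2.
  by rewrite -exprMn ler_pXn2r ?nnegrE// mulr_ge0// ltW.
have r2 : r ^+ 2 <= (q + 2 * d) ^+ 2.
  by rewrite ler_pXn2r ?nnegrE// addr_ge0// mulr_ge0// ltW.
have pE : p ^+ 2 = 4 - q ^+ 2 by lra.
rewrite pE in c2.
have qd : q * d <= 2 * d by rewrite ler_pM2r.
have sd : d <= s * d by rewrite ler_peMl// ltW.
(* The two parallelogram laws give [4 * (s - d) ^+ 2 <= s ^+ 2 * (4 - q ^+ 2) + (q + 2 * d) ^+ 2],
   so the left side is at most [8 * s * d + 4 * q * d]; then [qd] and [sd] apply. *)
have qs : (s ^+ 2 - 1) * q ^+ 2 <= 16 * (s * d) by nra.
have : (s ^+ 2 - 1) * q ^+ 2 < (s ^+ 2 - 1) * e ^+ 2.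
  by apply: lt_le_trans de; have := mulr_gt0 s0 d0; lra.
by rewrite ltr_pM2l// ltr_pXn2r ?nnegrE// ltW.
Unshelve. all: by end_near. Qed.

End RestrictedNorm.

(** * Convergence of the images under compact and finite-rank operators *)

Section Compactness.
Context {R : realType} {H : hilbertType R}.

Lemma compact_operator_ultra_cvg (K : {bounded H -> H}) (U : set_system H) :
  UltraFilter U -> compact_operator K -> U [set x | rnorm x = 1] ->
  exists l : H, K @ U --> l.
Proof.
move=> UU; rewrite /compact_operator precompactE => cK U1.
apply: (compact_ultra_cvg UU cK); apply: filterS U1 => x /= x1.
by apply: subset_closure; exists x => //=; rewrite rnormE x1.
Qed.

Lemma finite_rank_spanned (F : {bounded H -> H}) :
  finite_rank F -> exists s, spanned_by s (range F).
Proof.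
move=> [n [v ->]]; exists (codom v) => P Psub Pv _ [c _ <-].
apply: (big_ind P) => [|x y|i _]; first exact: Psub.1.
- exact: subspaceD.
- by apply: subspaceZ => //; apply: Pv; exact: codom_f.
Qed.

Lemma finite_rank_ultra_cvg (F : {bounded H -> H}) (U : set_system H) :
  UltraFilter U -> finite_rank F -> U [set x | rnorm x = 1] ->
  exists l : H, F @ U --> l.
Proof.
move=> UU /finite_rank_spanned[s Fs] U1; have [B B0 FB] := bounded_rnorm F.
apply: (spanned_ultra_cvg (B := B) UU Fs).
  by apply: filterS U1 => x _; exists x.
by apply: filterS U1 => x /= x1; rewrite (le_trans (FB x))// x1 mulr1.
Qed.

End Compactness.

(** * Norm attainment for [K \+ idfun \+ F] *)

Theorem theorem3p24 (R : realType) (H : hilbertType R)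
    (K F : {bounded H -> H}) :
  positive_operator K -> compact_operator K -> finite_rank F ->
  property_AN (K \+ idfun \+ F).
Proof.
move=> Kpos Kcpt Ffin M [/submod_closed_subspace Msub Mcl] Mn0.
set T := (X in restr_property_N X _).
have TE x : T x = x + (K \+ F) x by rewrite /= addrCA addrA.
have [U UU Umax] := maximizing_ultrafilter T Msub Mn0.
have [UM U1 Us] := Umax.
have [[x [Mx x1 Fx]]|kerF] :=
    pselect (exists x, [/\ M x, rnorm x = 1 & F x = 0]).
  have Tx : 1 <= rnorm (T x).
    by rewrite /= Fx addr0 -x1; exact: ler_rnorm_addP.
  have := restr_opnorm_ub T Msub Mx; rewrite x1 mulr1 => Txs.
  have [s1|s1] := leP (restr_opnorm T M) 1.
    (* Here [1 <= rnorm (T x) <= restr_opnorm T M <= 1], so equality holds throughout. *)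
    exists x; split; [exact: Mx|exact/rnorm1E|].
    rewrite rnormE; congr (_%:C); apply/eqP; rewrite eq_le Txs.
    exact: le_trans Tx.
  have [k Kk] := compact_operator_ultra_cvg UU Kcpt U1.
  have [f Ff] := finite_rank_ultra_cvg UU Ffin U1.
  have KF : (K \+ F) @ U --> k + f by exact: cvgD.
  have Uc : cauchy U by exact: (maximizing_cauchy Msub _ TE s1 Umax KF).
  have Ul : cvg U by exact: cauchy_cvg.
  exact: (maximizing_cvg Msub _ Mcl Umax Ul).
have [r Fr] := finite_rank_spanned Ffin.
have [e re] := gram_schmidt r.
(* If [F x] is orthogonal to all of [e], then [F x = frame_sum e (F x) = 0]; a nonzero such [x] in
   [M] would normalize to a unit vector excluded by [kerF]. *)
have [s sM] : exists s, spanned_by s M.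
  apply: (@spanned_by_separating _ _ F e) => // x Mx Fe.
  have Fx : F x = 0.
    have <- : frame_sum e (F x) = F x.
      apply: (Fr [set x | frame_sum e x = x]); [exact: frame_sum_subspace| |].
        by move=> y yr; apply: re; rewrite mem_cat yr orbT.
      by exists x.
    by rewrite /frame_sum big_seq big1// => y /Fe ->; rewrite scale0r.
  apply: contrapT => /eqP x0; apply: kerF; exists ((rnorm x)^-1%:C *: x); split.
  - exact: subspaceZ.
  - by rewrite rnormZ ?invr_ge0 ?rnorm_ge0// mulVf ?rnorm_eq0.
  - by rewrite linearZ/= Fx scaler0.
have [l Ul] : exists l : H, id @ U --> l.
  apply: (spanned_ultra_cvg (B := 1) UU sM) => //.
  by apply: filterS U1 => x /= ->.
exact: maximizing_cvg Ul.
Qed.
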